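(* Let $n,m\in\mathbb{N}$ and $\Phi\in\mathrm{UCP}(M_n(\mathbb{R}),M_m(\mathbb{R}))$. Then $\Phi\in\mathrm{UCP}_{C^*-ext}(M_n(\mathbb{R}),M_m(\mathbb{R}))$ if and only if there exists a nested sequence of compressions $\{\Phi_j\}_{j=1}^k$ of the identity representation of $M_n(\mathbb{R})$ (on $\mathbb{R}^n$) such that $\Phi$ is unitarily equivalent to the direct sum $\bigoplus_{j=1}^k\Phi_j$.
   Context: All linear maps are real linear; $M_n(\mathbb{R})=\mathscr{B}(\mathbb{R}^n)$ with $T^*$ the transpose; unitary means real orthogonal. For a unital real $C^*$-algebra $\mathcal{A}$ and a real Hilbert space $\mathcal{H}$, a real linear $\Phi:\mathcal{A}\to\mathscr{B}(\mathcal{H})$ is completely positive (CP) if $\sum_{i,j=1}^rT_i^*\Phi(a_i^*a_j)T_j\ge0$ (i.e. is of the form $B^*B$) for all finite families $a_j\in\mathcal{A}$, $T_j\in\mathscr{B}(\mathcal{H})$. $\mathrm{UCP}(\mathcal{A},\mathscr{B}(\mathcal{H}))$ is the set of CP maps with $\Phi(1)=I$. $\mathrm{Ad}_T(X)=T^*XT$. UCP maps $\Phi:\mathcal{A}\to\mathscr{B}(\mathcal{H})$, $\Psi:\mathcal{A}\to\mathscr{B}(\mathcal{H}')$ are unitarily equivalent ($\Phi\sim\Psi$) if $\Psi(\cdot)=U^*\Phi(\cdot)U$ for some unitary $U:\mathcal{H}'\to\mathcal{H}$. Direct sums of maps are defined by $(\bigoplus_j\Phi_j)(a)=\bigoplus_j\Phi_j(a)$.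 $\Phi\in\mathrm{UCP}(\mathcal{A},\mathscr{B}(\mathcal{H}))$ is a $C^*$-extreme point (written $\Phi\in\mathrm{UCP}_{C^*-ext}(\mathcal{A},\mathscr{B}(\mathcal{H}))$) if whenever $\Phi=\sum_{j=1}^r\mathrm{Ad}_{T_j}\circ\Phi_j$ with $\Phi_j\in\mathrm{UCP}(\mathcal{A},\mathscr{B}(\mathcal{H}))$ and invertible $T_j\in\mathscr{B}(\mathcal{H})$ satisfying $\sum_jT_j^*T_j=I$, then $\Phi_j\sim\Phi$ for all $j$. A UCP map $\Psi:\mathcal{A}\to\mathscr{B}(\mathcal{G})$ is a compression of a UCP map $\Phi:\mathcal{A}\to\mathscr{B}(\mathcal{H})$ if $\Psi(\cdot)=W^*\Phi(\cdot)W$ for some isometry $W:\mathcal{G}\to\mathcal{H}$. A nested sequence of compressions of a representation (unital $*$-homomorphism) $\pi$ is a finite sequence $\{\Phi_j\}_j$ of UCP maps $\Phi_j:\mathcal{A}\to\mathscr{B}(\mathcal{H}_j)$ such that $\Phi_1$ is a compression of $\pi$ and $\Phi_{j+1}$ is a compression of $\Phi_j$ for each $j\ge1$.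
   Formalization: Complete positivity is taken to include Φ(a* ) = Φ(a)*, which follows from the stated sum condition unless m = 1; for m = 1, n ≥ 2 the literal claim fails, e.g. x₁₁ is the average of the literally UCP maps x₁₁ ± (x₁₂ − x₂₁). *)

(* Defs.v *)
From HB Require Import structures.
From mathcomp Require Import all_boot all_order all_algebra.
From mathcomp Require Import reals.

Set Implicit Arguments.
Unset Strict Implicit.
Unset Printing Implicit Defensive.

Import GRing.Theory.
Local Open Scope ring_scope.

Definition psd (R : realType) (m : nat) (X : 'M[R]_m) : Prop :=
  exists B : 'M[R]_m, X = B^T *m B.

Definition cp_sums (R : realType) (n m : nat)
    (Phi : {linear 'M[R]_n -> 'M[R]_m}) : Prop :=
  forall (r : nat) (a : 'I_r -> 'M[R]_n) (T : 'I_r -> 'M[R]_m),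
    psd (\sum_(i < r) \sum_(j < r)
           (T i)^T *m Phi ((a i)^T *m a j) *m T j).

Definition hermitian_map (R : realType) (n m : nat)
    (Phi : {linear 'M[R]_n -> 'M[R]_m}) : Prop :=
  forall a : 'M[R]_n, Phi a^T = (Phi a)^T.

(* Over the reals, positivity of the sums in [cp_sums] forces
   [Phi a^T = (Phi a)^T] when [m != 1] (see [cp_sums_hermitian]), but not when
   [m = 1]: 1 x 1 matrices are all symmetric and commute, so the sums collapse
   to [Phi (b^T *m b)] and say nothing about [Phi] on skew-symmetric matrices,
   whereas every amplification of a completely positive map has to preserve
   symmetry.  The clause [hermitian_map] therefore only matters for [m = 1]. *)
Definition cp (R : realType) (n m : nat)
    (Phi : {linear 'M[R]_n -> 'M[R]_m}) : Prop :=
  hermitian_map Phi /\ cp_sums Phi.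

Lemma cp_sums_hermitian (R : realType) (n m : nat)
    (Phi : {linear 'M[R]_n -> 'M[R]_m}) :
  m != 1%N -> cp_sums Phi -> hermitian_map Phi.
Proof.
move=> m_neq1 PhiP a; case: m m_neq1 Phi PhiP => [|[//|m]] _ Phi PhiP.
  by apply/matrixP => -[].
pose p0 : 'I_m.+2 := ord0; pose p1 : 'I_m.+2 := lift ord0 ord0.
apply/matrixP => p q.
pose b (i : 'I_2) : 'M[R]_n := if i == 0 then 1%:M else a.
pose s (i : 'I_2) := if i == 0 then q else p.
pose t (i : 'I_2) := if i == 0 then p0 else p1.
have [B defB] := PhiP 2%N b (fun i => delta_mx (s i) (t i)).
have E (u v w z : 'I_m.+2) (X : 'M[R]_m.+2) (i j : 'I_m.+2) :
    ((delta_mx u v)^T *m X *m delta_mx w z) i j =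
    X u w *+ ((v == i) && (z == j)).
  rewrite trmx_delta mxE (bigD1 w) //= big1 => [|k nkw].
    rewrite addr0 !mxE eqxx /= (bigD1 u) //= big1 => [|k nku].
      rewrite addr0 !mxE eqxx andbT (eq_sym i) (eq_sym j).
      by do 2 case: (_ == _); rewrite ?mulr1 ?mulr0 ?mul1r ?mul0r.
    by rewrite !mxE (negPf nku) andbF mul0r.
  by rewrite !mxE (negPf nkw) mulr0.
have sumE i j : (B^T *m B) i j = \sum_(k < 2) \sum_(l < 2)
    Phi ((b k)^T *m b l) (s k) (s l) *+ ((t k == i) && (t l == j)).
  rewrite -defB summxE; apply: eq_bigr => k _.
  by rewrite summxE; apply: eq_bigr => l _; rewrite E.
have : (B^T *m B) p0 p1 = (B^T *m B) p1 p0.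
  by rewrite -[in LHS](trmxK B) -trmx_mul trmxK mxE.
rewrite !sumE !big_ord_recl !big_ord0 /b /s /t /= !trmx1 !mul1mx !mulmx1.
rewrite !addr0 !add0r => Eqp; rewrite [RHS]mxE; exact: esym Eqp.
Qed.

Definition ucp (R : realType) (n m : nat)
    (Phi : {linear 'M[R]_n -> 'M[R]_m}) : Prop :=
  cp Phi /\ Phi 1%:M = 1%:M.

Definition isometry (R : realType) (p q : nat) (W : 'M[R]_(p, q)) : Prop :=
  W^T *m W = 1%:M.

Definition unitary (R : realType) (p q : nat) (U : 'M[R]_(p, q)) : Prop :=
  U^T *m U = 1%:M /\ U *m U^T = 1%:M.

Definition Ad (R : realType) (p q : nat) (T : 'M[R]_(p, q)) (X : 'M[R]_p) :
  'M[R]_q := T^T *m X *m T.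

Definition unitarily_equiv (R : realType) (n p q : nat)
    (Phi : 'M[R]_n -> 'M[R]_p) (Psi : 'M[R]_n -> 'M[R]_q) : Prop :=
  exists U : 'M[R]_(p, q), unitary U /\ forall a, Psi a = Ad U (Phi a).

Definition cstar_extreme (R : realType) (n m : nat)
    (Phi : {linear 'M[R]_n -> 'M[R]_m}) : Prop :=
  ucp Phi /\
  forall (r : nat) (T : 'I_r -> 'M[R]_m)
         (Phis : 'I_r -> {linear 'M[R]_n -> 'M[R]_m}),
    (forall j, ucp (Phis j)) ->
    (forall j, T j \in unitmx) ->
    \sum_(j < r) (T j)^T *m T j = 1%:M ->
    (forall a, Phi a = \sum_(j < r) Ad (T j) (Phis j a)) ->
    forall j, unitarily_equiv (Phis j) Phi.

Definition compression (R : realType) (n p q : nat)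
    (Psi : 'M[R]_n -> 'M[R]_q) (Phi : 'M[R]_n -> 'M[R]_p) : Prop :=
  exists W : 'M[R]_(p, q), isometry W /\ forall a, Psi a = Ad W (Phi a).

Definition representation (R : realType) (n p : nat)
    (pi : {linear 'M[R]_n -> 'M[R]_p}) : Prop :=
  [/\ pi 1%:M = 1%:M,
      forall a b, pi (a *m b) = pi a *m pi b
    & forall a, pi a^T = (pi a)^T].

(* Sequences are indexed from 0.  A compression of a map into ['M[R]_p] acts on
   a space of dimension at most [p], so there is no loss in taking the spaces
   of the sequence to be [R^(d j)]. *)
Definition nested_compressions (R : realType) (n p : nat)
    (pi : {linear 'M[R]_n -> 'M[R]_p}) (k : nat) (d : 'I_k -> nat)
    (Phis : forall j : 'I_k, {linear 'M[R]_n -> 'M[R]_(d j)}) : Prop :=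
  [/\ representation pi,
      forall j, ucp (Phis j),
      forall j : 'I_k, j = 0%N :> nat -> compression (Phis j) pi
    & forall i j : 'I_k, j = i.+1 :> nat -> compression (Phis j) (Phis i)].

Definition direct_sum (R : realType) (n k : nat) (d : 'I_k -> nat)
    (Phis : forall j : 'I_k, {linear 'M[R]_n -> 'M[R]_(d j)}) (a : 'M[R]_n) :
  'M[R]_(\sum_(j < k) d j) := \mxdiag_(j < k) Phis j a.

(* Main.v *)
Require Import Defs.
From HB Require Import structures.
From mathcomp Require Import all_boot all_order all_algebra.
From mathcomp Require Import boolp reals.

Set Implicit Arguments.
Unset Strict Implicit.
Unset Printing Implicit Defensive.

Import Order.TTheory GRing.Theory Num.Theory.
Local Open Scope ring_scope.

(* By Choi's theorem [Phi a = \sum_l V_l^T a V_l] with linearly independent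
   [V_l], and two such families define the same map iff they have the same Gram
   matrix; in particular the coefficients of a map dominated by [Phi] form a
   Gram matrix [C^T C].

   If [Phi] is a direct sum of nested compressions, a triangular (Cholesky)
   factor [L] of [C^T C = L^T L] satisfies [L V = V S] for some [S], because the
   ranges of the [V_l] decrease; [S] then yields the unitary equivalence.

   Conversely, if [Phi] is C*-extreme, the algebra of the [L] such that [L V]
   has the form [V S] contains, for each positive definite [D], some [L] with
   [L^T L = D].  Letting [D] tend to rank one projections, this algebra contains
   some [y^T x], [y <> 0], for each row [x], then a common [y] for all [x], and
   by induction on the size it contains the upper triangular matrices of some
   orthonormal basis.  Rewritten in this basis, the [V_l] are partial isometries
   with orthogonal initial spaces and decreasing ranges. *)

(** * Gram matrices and the Cholesky factorisation *)

Definition upper_triangular (R : realType) (k : nat) (L : 'M[R]_k) : Prop :=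
  forall i j : 'I_k, (j < i)%N -> L i j = 0.

Lemma gram_diag_ge0 (R : realType) (p q : nat) (A : 'M[R]_(p, q)) (i : 'I_q) :
  0 <= (A^T *m A) i i.
Proof.
by rewrite mxE sumr_ge0 // => j _; rewrite mxE -expr2 sqr_ge0.
Qed.

Lemma sum_gram_eq0 (R : realType) (I : finType) (p : I -> nat) (q : nat)
    (A : forall i, 'M[R]_(p i, q)) :
  \sum_i (A i)^T *m A i = 0 -> forall i, A i = 0.
Proof.
move=> sA0 i; apply/matrixP => s t; rewrite [RHS]mxE.
have /matrixP/(_ t t) := sA0; rewrite summxE [RHS]mxE => /eqP.
rewrite psumr_eq0 => [|j _]; last exact: gram_diag_ge0.
move=> /allP/(_ i (mem_index_enum i)) /=; rewrite mxE.
rewrite psumr_eq0 => [|j _]; last by rewrite mxE -expr2 sqr_ge0.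
move=> /allP/(_ s (mem_index_enum s)) /=.
by rewrite mxE mulf_eq0 orbb => /eqP.
Qed.

Lemma gram_eq0 (R : realType) (p q : nat) (A : 'M[R]_(p, q)) :
  A^T *m A = 0 -> A = 0.
Proof.
move=> A0; apply: (@sum_gram_eq0 _ 'I_1 (fun=> p) _ (fun=> A) _ ord0).
by rewrite big_ord1.
Qed.

(** Multiplying by the cokernel of [V] on both sides gives a vanishing sum of Gram matrices, so each
    term vanishes. This yields the coefficients of a Kraus family dominated by [V]. *)
Lemma sum_gram_submx (R : realType) (I : finType) (p : I -> nat) (k q : nat)
    (A : forall i, 'M[R]_(p i, q)) (V : 'M[R]_(k, q)) :
  \sum_i (A i)^T *m A i = V^T *m V -> forall i, (A i <= V)%MS.
Proof.
move=> AV i; rewrite submxE; apply/eqP; move: i.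
apply: sum_gram_eq0.
under eq_bigr => i _ do rewrite trmx_mul mulmxA -(mulmxA _ (A i)^T).
rewrite -mulmx_suml -mulmx_sumr AV.
by rewrite -!mulmxA mulmx_coker !mulmx0.
Qed.

Lemma gram_submx (R : realType) (p k q : nat)
    (A : 'M[R]_(p, q)) (V : 'M[R]_(k, q)) :
  A^T *m A = V^T *m V -> (A <= V)%MS.
Proof.
move=> AV; apply: (@sum_gram_submx _ 'I_1 (fun=> p) _ _ (fun=> A) _ _ ord0).
by rewrite big_ord1.
Qed.

Lemma gram_rank (R : realType) (p k q : nat)
    (A : 'M[R]_(p, q)) (V : 'M[R]_(k, q)) :
  A^T *m A = V^T *m V -> \rank A = \rank V.
Proof.
move=> AV; apply/eqP; rewrite eqn_leq.
by rewrite !mxrankS //; apply: gram_submx.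
Qed.

Lemma unitmx_gram (R : realType) (m : nat) (S T : 'M[R]_m) :
  S^T *m S = T^T *m T -> T \in unitmx -> S \in unitmx.
Proof. by move=> ST; rewrite -!row_free_unit /row_free (gram_rank ST). Qed.

Lemma row_gram_ge0 (R : realType) m (x : 'rV[R]_m) : 0 <= (x *m x^T) 0 0.
Proof. by have := gram_diag_ge0 x^T 0; rewrite trmxK. Qed.

Definition form_ge0 (R : realType) (m : nat) (X : 'M[R]_m) : Prop :=
  X^T = X /\ forall x : 'rV[R]_m, 0 <= (x *m X *m x^T) 0 0.

Lemma form_ge0_gram (R : realType) (p m : nat) (A : 'M[R]_(p, m)) :
  form_ge0 (A^T *m A).
Proof.
split=> [|x]; first by rewrite trmx_mul trmxK.
have := gram_diag_ge0 (A *m x^T) 0.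
by rewrite trmx_mul trmxK !mulmxA.
Qed.

Lemma form_ge0_sum (R : realType) (I : finType) (m : nat) (X : I -> 'M[R]_m) :
  (forall i, form_ge0 (X i)) -> form_ge0 (\sum_i X i).
Proof.
move=> XP; split=> [|x].
  by rewrite linear_sum; apply: eq_bigr => i _; case: (XP i).
rewrite mulmx_sumr mulmx_suml summxE sumr_ge0 // => i _.
by case: (XP i).
Qed.

(** Induction through the Schur complement of the corner [a]. The form is only semidefinite: if
    [a = 0], the rest [b] of the first row vanishes too and [L] gets a zero row. *)
Lemma cholesky (R : realType) (m : nat) (X : 'M[R]_m) :
  form_ge0 X -> exists2 L : 'M[R]_m, upper_triangular L & X = L^T *m L.
Proof.
elim: m X => [|m IH] X [symX posX].
  by exists 0 => [[]//|]; apply/matrixP => -[].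
rewrite -[m.+1]/(1 + m)%N in X symX posX *.
have [a [b [Y defX]]] : exists a b (Y : 'M_m),
    X = block_mx (a%:M : 'M_1) b b^T Y.
  exists (X ord0 ord0), (ursubmx X), (drsubmx X).
  rewrite -{1}(submxK X) trmx_ursub symX; congr block_mx.
  apply/matrixP => i j; rewrite !ord1 !mxE mulr1n.
  by congr (X _ _); apply: val_inj.
have s0 : 0%:M = 0 :> 'M[R]_1 by rewrite -scalemx1 scale0r.
have symY : Y^T = Y.
  by move: symX; rewrite defX tr_block_mx => /eq_block_mx[].
have a_ge0 : 0 <= a.
  have := posX (row_mx (1%:M : 'M_1) (0 : 'rV_m)).
  rewrite defX tr_row_mx mul_row_block mul_row_col !mul0mx trmx0 !mulmx0.
  by rewrite !addr0 trmx1 !mul1mx mulmx1 !mxE mulr1n.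
have [a0|a_neq0] := eqVneq a 0.
  have b0 : b = 0.
    apply: trmx_inj; rewrite trmx0; apply: gram_eq0; rewrite trmxK.
    rewrite [LHS]mx11_scalar.
    have [->|/eqP b_neq0] := (b *m b^T) 0 0 =P 0; first exact: s0.
    pose be := (b *m b^T) 0 0; pose ga := (b *m Y *m b^T) 0 0.
    (* With this [c] the form takes the value [2 * c * be + ga = -1] at the row [(c, b)]. *)
    pose c := - (ga + 1) / (be + be).
    have := posX (row_mx (c%:M : 'M_1) b).
    rewrite defX tr_row_mx mul_row_block mul_row_col a0 s0.
    rewrite mulmx0 add0r tr_scalar_mx mul_mx_scalar mul_scalar_mx mulmxDl.
    rewrite -scalemxAl addrA -scalerDl mxE [X in X + _]mxE -/be -/ga.
    have -> : (c + c) * be = - (ga + 1).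
      rewrite mulrDl -mulrDr /c mulrVK // unitfE -mulr2n mulrn_eq0.
      by rewrite negb_or b_neq0.
    by rewrite opprD addrAC addNr add0r oppr_ge0 ler10.
  have [|L' triL' defY] := IH Y.
    split=> // x; have := posX (row_mx 0 x).
    rewrite defX tr_row_mx mul_row_block mul_row_col !mul0mx trmx0 !mulmx0.
    by rewrite !add0r.
  exists (block_mx (0 : 'M_1) 0 0 L').
    move=> i j; rewrite -[i](@splitK 1 m) -[j](@splitK 1 m).
    case: split => i'; case: split => j' /=; rewrite ?block_mxEul ?block_mxEdl
      ?block_mxEur ?block_mxEdr ?mxE //; exact: triL'.
  rewrite defX a0 b0 s0 !trmx0 defY tr_block_mx !trmx0 mulmx_block.
  by rewrite !mul0mx !mulmx0 !addr0 add0r.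
pose S := Y - a^-1 *: (b^T *m b).
have [|L' triL' defS] := IH S.
  split=> [|x].
    by rewrite /S linearB linearZ /= trmx_mul trmxK symY.
  (* The first entry makes the product of this row with the first column of [X] vanish; the form of
     [S] at [x] remains. *)
  have := posX (row_mx (- a^-1 *: (x *m b^T)) x).
  rewrite defX tr_row_mx mul_row_block mul_mx_scalar scalerA mulrN mulfV //.
  rewrite scaleN1r addNr mul_row_col mul0mx add0r -scalemxAl scaleNr addrC.
  by rewrite -mulmxA scalemxAr -mulmxBr.
pose s := Num.sqrt a.
have s_neq0 : s != 0 by rewrite sqrtr_eq0 -ltNge lt_def a_neq0.
have ss : s * s = a by rewrite -expr2 sqr_sqrtr.
exists (block_mx (s%:M : 'M_1) (s^-1 *: b) 0 L').
  move=> i j; rewrite -[i](@splitK 1 m) -[j](@splitK 1 m).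
  case: split => i'; case: split => j' /=; rewrite ?block_mxEul ?block_mxEdl
    ?block_mxEur ?block_mxEdr ?mxE ?ord1 //; exact: triL'.
rewrite defX tr_block_mx mulmx_block !trmx0 !mulmx0 !mul0mx !addr0.
rewrite -defS tr_scalar_mx -scalar_mxM ss mul_scalar_mx mul_mx_scalar.
rewrite [(_ *: b)^T]linearZ /= !scalerA mulfV // !scale1r -scalemxAl.
rewrite -scalemxAr scalerA.
by rewrite -invfM ss /S addrC subrK.
Qed.

Lemma psdP (R : realType) (m : nat) (X : 'M[R]_m) : psd X <-> form_ge0 X.
Proof.
split=> [[B ->]|/cholesky[L _ ->]]; [exact: form_ge0_gram | by exists L].
Qed.

Lemma qr (R : realType) (p m : nat) (A : 'M[R]_(p, m)) :
  exists2 L : 'M[R]_m, upper_triangular L & L^T *m L = A^T *m A.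
Proof. by have [L ? ->] := cholesky (form_ge0_gram A); exists L. Qed.

(** Gram-Schmidt: a column basis [C] of [A], divided by the Cholesky factor [T] of [C^T *m C],
    becomes orthonormal. *)
Lemma orthonormal_col_base (R : realType) (p m : nat) (A : 'M[R]_(p, m)) :
  exists (d : nat) (W : 'M[R]_(p, d)),
    Defs.isometry W /\ exists Y, A *m Y = W /\ W *m W^T *m A = A.
Proof.
pose C := (row_base A^T)^T.
have [T _ TC] := qr C.
have uT : T \in unitmx.
  rewrite -row_free_unit /row_free (gram_rank TC) mxrank_tr.
  by rewrite eq_row_base.
pose W := C *m invmx T.
have [Y defC] : exists Y, C = A *m Y.
  have /submxP[Y defY] : (row_base A^T <= A^T)%MS by rewrite eq_row_base.
  by exists Y^T; rewrite /C defY trmx_mul trmxK.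
have [Z defA] : exists Z, A = C *m Z.
  have /submxP[Y' defY] : (A^T <= row_base A^T)%MS by rewrite eq_row_base.
  by exists Y'^T; apply: trmx_inj; rewrite trmx_mul !trmxK.
have isoW : W^T *m W = 1%:M.
  rewrite trmx_mul mulmxA -(mulmxA _ C^T) -TC mulmxA -trmx_mul mulmxV //.
  by rewrite trmx1 mul1mx mulmxV.
exists (\rank A^T), W; split; first exact: isoW.
exists (Y *m invmx T); rewrite mulmxA -defC; split=> //.
have E : A = W *m (T *m Z) by rewrite /W mulmxA mulmxKV.
apply: (etrans (congr1 (mulmx (W *m W^T)) E)).
by rewrite mulmxA -(mulmxA W) isoW mulmx1 -E.
Qed.

(** * Kraus families *)

Lemma Ad_linear (R : realType) (p q : nat) (T : 'M[R]_(p, q)) : linear (Ad T).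
Proof.
by move=> c X Y; rewrite /Ad mulmxDr mulmxDl -scalemxAr -scalemxAl.
Qed.

HB.instance Definition _ (R : realType) (p q : nat) (T : 'M[R]_(p, q)) :=
  GRing.isLinear.Build R 'M[R]_p 'M[R]_q _ (Ad T) (Ad_linear T).

Lemma AdM (R : realType) (p q r : nat) (S : 'M[R]_(p, q)) (T : 'M[R]_(q, r))
  (X : 'M[R]_p) : Ad (S *m T) X = Ad T (Ad S X).
Proof. by rewrite /Ad trmx_mul !mulmxA. Qed.

Lemma Ad1 (R : realType) (p : nat) (X : 'M[R]_p) : Ad 1%:M X = X.
Proof. by rewrite /Ad trmx1 mul1mx mulmx1. Qed.

(* A family of [k] Kraus operators of size [n x m] is encoded by the
   [k x (n * m)] matrix whose rows are the vectorised operators: two families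
   then define the same map exactly when they have the same Gram matrix
   [V^T *m V], the Choi matrix of the map. *)
Definition kop (R : realType) (n m k : nat) (V : 'M[R]_(k, n * m)) (l : 'I_k) :
  'M[R]_(n, m) := vec_mx (row l V).

Definition kraus (R : realType) (n m k : nat) (V : 'M[R]_(k, n * m))
  (a : 'M[R]_n) : 'M[R]_m := \sum_(l < k) Ad (kop V l) a.

Definition kmul (R : realType) (n m p k : nat) (V : 'M[R]_(k, n * m))
  (S : 'M[R]_(m, p)) : 'M[R]_(k, n * p) := V *m lin_mx (mulmxr S).

Lemma kraus_linear (R : realType) (n m k : nat) (V : 'M[R]_(k, n * m)) :
  linear (kraus V).
Proof.
move=> c a b; rewrite /kraus scaler_sumr -big_split /=.
by apply: eq_bigr => l _; rewrite linearP.
Qed.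

HB.instance Definition _ (R : realType) (n m k : nat) (V : 'M[R]_(k, n * m)) :=
  GRing.isLinear.Build R 'M[R]_n 'M[R]_m _ (kraus V) (kraus_linear V).

Section Kraus.
Variables (R : realType) (n m : nat).

Lemma kopE k (V : 'M[R]_(k, n * m)) l i j : kop V l i j = V l (mxvec_index i j).
Proof. by rewrite !mxE. Qed.

Lemma kop_inj k (V W : 'M[R]_(k, n * m)) : kop V =1 kop W -> V = W.
Proof.
by move=> VW; apply/row_matrixP => l; apply: (can_inj vec_mxK); apply: VW.
Qed.

Lemma kop_kmul p k (V : 'M[R]_(k, n * m)) (S : 'M[R]_(m, p)) l :
  kop (kmul V S) l = kop V l *m S.
Proof. by rewrite /kop row_mul mul_rV_lin mxvecK. Qed.

Lemma kop_mul k r (L : 'M[R]_(r, k)) (V : 'M[R]_(k, n * m)) l :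
  kop (L *m V) l = \sum_q L l q *: kop V q.
Proof.
rewrite /kop row_mul mulmx_sum_row linear_sum.
by apply: eq_bigr => q _; rewrite linearZ /= mxE.
Qed.

Lemma kmul_mul p k r (L : 'M[R]_(r, k)) (V : 'M[R]_(k, n * m))
  (S : 'M[R]_(m, p)) : kmul (L *m V) S = L *m kmul V S.
Proof. by rewrite /kmul mulmxA. Qed.

Lemma kraus_kmul p k (V : 'M[R]_(k, n * m)) (S : 'M[R]_(m, p)) a :
  kraus (kmul V S) a = Ad S (kraus V a).
Proof.
rewrite /kraus linear_sum; apply: eq_bigr => l _.
by rewrite kop_kmul AdM.
Qed.

Lemma kraus_delta k (V : 'M[R]_(k, n * m)) s t x y :
  kraus V (delta_mx s t) x y = (V^T *m V) (mxvec_index s x) (mxvec_index t y).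
Proof.
rewrite summxE [RHS]mxE; apply: eq_bigr => l _.
rewrite mxE (bigD1 t) //= big1 => [|j ntj].
  rewrite addr0 mxE (bigD1 s) //= big1 => [|i nsi].
    by rewrite addr0 mxE kopE mxE !eqxx mulr1 kopE mxE.
  by rewrite [delta_mx _ _ _ _]mxE (negPf nsi) mulr0.
rewrite mxE big1 ?mul0r // => i _.
by rewrite [delta_mx _ _ _ _]mxE (negPf ntj) andbF mulr0.
Qed.

Lemma krausE k (V : 'M[R]_(k, n * m)) a x y :
  kraus V a x y =
    \sum_s \sum_t a s t * (V^T *m V) (mxvec_index s x) (mxvec_index t y).
Proof.
rewrite {1}[a]matrix_sum_delta linear_sum summxE; apply: eq_bigr => s _.
rewrite linear_sum summxE; apply: eq_bigr => t _.
by rewrite linearZ mxE kraus_delta.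
Qed.

Lemma kraus_sum_gram (I : finType) (r : I -> nat) k (V : 'M[R]_(k, n * m))
    (W : forall i, 'M[R]_(r i, n * m)) :
  (forall a, kraus V a = \sum_i kraus (W i) a) <->
  V^T *m V = \sum_i (W i)^T *m W i.
Proof.
split=> [VW|VW a].
  apply/matrixP => i j; case/mxvec_indexP: i => s x.
  case/mxvec_indexP: j => t y.
  rewrite -kraus_delta VW !summxE; apply: eq_bigr => l _.
  by rewrite kraus_delta.
apply/matrixP => x y; rewrite krausE VW summxE.
under [RHS]eq_bigr => l _ do rewrite krausE.
rewrite [RHS]exchange_big; apply: eq_bigr => s _.
rewrite [RHS]exchange_big; apply: eq_bigr => t _.
by rewrite summxE mulr_sumr.
Qed.

Lemma kraus_gram k r (V : 'M[R]_(k, n * m)) (W : 'M[R]_(r, n * m)) :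
  kraus V =1 kraus W <-> V^T *m V = W^T *m W.
Proof.
have := @kraus_sum_gram 'I_1 (fun=> r) k V (fun=> W); rewrite big_ord1 => <-.
by split=> VW a; have := VW a; rewrite big_ord1.
Qed.

Lemma kraus_cp k (V : 'M[R]_(k, n * m)) : cp (kraus V).
Proof.
split=> [a|r a T].
  rewrite /= /kraus [RHS]linear_sum; apply: eq_bigr => l _.
  by rewrite /= /Ad !trmx_mul trmxK mulmxA.
apply/psdP.
have -> : \sum_i \sum_j (T i)^T *m kraus V ((a i)^T *m a j) *m T j =
    \sum_l (\sum_i a i *m kop V l *m T i)^T *m (\sum_i a i *m kop V l *m T i).
  under [RHS]eq_bigr => l _ do rewrite [X in X *m _]linear_sum /= mulmx_suml.
  rewrite [RHS]exchange_big; apply: eq_bigr => i _.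
  under [RHS]eq_bigr => l _ do rewrite mulmx_sumr.
  rewrite [RHS]exchange_big; apply: eq_bigr => j _.
  rewrite mulmx_sumr mulmx_suml; apply: eq_bigr => l _.
  by rewrite /Ad !trmx_mul !mulmxA.
by apply: form_ge0_sum => l; apply: form_ge0_gram.
Qed.

(** In [V = Y *m row_base V], replacing [Y] by a square [T] with the same Gram matrix leaves
    [\rank V] rows and keeps the Gram matrix, hence the rank. *)
Lemma row_free_gram q r (V : 'M[R]_(r, q)) :
  exists (k : nat) (W : 'M[R]_(k, q)), row_free W /\ W^T *m W = V^T *m V.
Proof.
have /submxP[Y defV] : (V <= row_base V)%MS by rewrite eq_row_base.
have [T _ TY] := qr Y; exists (\rank V), (T *m row_base V).
have VE : (T *m row_base V)^T *m (T *m row_base V) = V^T *m V.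
  rewrite (trmx_mul T) -mulmxA (mulmxA T^T) TY [in RHS]defV (trmx_mul Y).
  by rewrite -!mulmxA.
by split; rewrite // /row_free (gram_rank VE).
Qed.

Lemma cp_kraus (Phi : {linear 'M[R]_n -> 'M[R]_m}) :
    (0 < n)%N -> (0 < m)%N -> cp Phi ->
  exists (k : nat) (V : 'M[R]_(k, n * m)), row_free V /\ Phi =1 kraus V.
Proof.
move=> n_gt0 m_gt0 [herPhi posPhi].
pose mi (u : 'I_n * 'I_m) := mxvec_index u.1 u.2.
have mi_bij : bijective mi.
  by apply: (eq_bij (onT_bij (curry_mxvec_bij n m))) => -[].
have sum_mi (F : 'I_(n * m) -> R) :
    \sum_i F i = \sum_s \sum_x F (mxvec_index s x).
  by rewrite (reindex mi) ?pair_bigA //; apply: onW_bij.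
have [C CE] : exists C : 'M[R]_(n * m), forall s x t y,
    C (mxvec_index s x) (mxvec_index t y) = Phi (delta_mx s t) x y.
  have [g miK _] := mi_bij.
  exists (\matrix_(i, j) Phi (delta_mx (g i).1 (g j).1) (g i).2 (g j).2).
  by move=> s x t y; rewrite mxE (miK (s, x)) (miK (t, y)).
have [|L _ defC] := @cholesky R _ C.
  split=> [|z].
    apply/matrixP => i j; case/mxvec_indexP: i => s x.
    case/mxvec_indexP: j => t y; rewrite mxE !CE -trmx_delta herPhi.
    by rewrite mxE.
  (* All columns of [T s] are the [s]-th block of [z], so that, for the matrix units [delta_mx 0 s],
     every entry of the sum in [cp_sums] is [z *m C *m z^T]. *)
  pose T s : 'M[R]_m := \matrix_(x, _) z 0 (mxvec_index s x).
  have [B defB] := posPhi n (delta_mx (Ordinal n_gt0)) T.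
  pose j0 := Ordinal m_gt0.
  have := gram_diag_ge0 B j0; rewrite -defB; congr (0 <= _).
  rewrite summxE mxE sum_mi; under eq_bigr => s _ do rewrite summxE.
  rewrite exchange_big; apply: eq_bigr => t _; rewrite /=.
  under eq_bigr => s _ do rewrite trmx_delta mul_delta_mx mxE.
  rewrite exchange_big; apply: eq_bigr => y _; rewrite /=.
  rewrite [z^T _ _]mxE [in RHS]mxE sum_mi mulr_suml; apply: eq_bigr => s _.
  rewrite !mxE; congr (_ * _); apply: eq_bigr => x _.
  by rewrite !mxE CE.
have [k [V [freeV VL]]] := row_free_gram L; exists k, V; split=> //.
move=> a; apply/matrixP => x y; rewrite krausE VL -defC.
rewrite {1}[a]matrix_sum_delta linear_sum summxE; apply: eq_bigr => s _.
rewrite linear_sum summxE; apply: eq_bigr => t _.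
by rewrite linearZ mxE CE.
Qed.
End Kraus.

Lemma kmulA (R : realType) (n m p q k : nat) (V : 'M[R]_(k, n * m))
  (S : 'M[R]_(m, p)) (T : 'M[R]_(p, q)) : kmul V (S *m T) = kmul (kmul V S) T.
Proof. by apply: kop_inj => l; rewrite !kop_kmul mulmxA. Qed.

(** * Nested families *)

Lemma kop_mx (R : realType) (n m k : nat) (F : 'I_k -> 'M[R]_(n, m)) l :
  kop (\matrix_l mxvec (F l)) l = F l.
Proof. by rewrite /kop rowK mxvecK. Qed.

(* The [kop V q] are partial isometries with pairwise orthogonal initial spaces
   and with final projections [kop V q *m (kop V q)^T] decreasing in [q]. *)
Definition nested (R : realType) (n m k : nat) (V : 'M[R]_(k, n * m)) : Prop :=
  forall t p q : 'I_k, (p <= q)%N ->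
    kop V t *m ((kop V p)^T *m kop V q) = kop V q *+ (t == p).

(** For [p <= q], right multiplication by [(kop V p)^T *m kop V q] acts on the family as left
    multiplication by [delta_mx p q] does, and [L] combines only such pairs. *)
Lemma nested_mul_triangular (R : realType) (n m k : nat)
    (V : 'M[R]_(k, n * m)) (L : 'M[R]_k) :
  nested V -> upper_triangular L -> exists S : 'M[R]_m, L *m V = kmul V S.
Proof.
move=> nestV triL.
exists (\sum_p \sum_q L p q *: ((kop V p)^T *m kop V q)).
apply: kop_inj => t; rewrite kop_mul kop_kmul mulmx_sumr [RHS](bigD1 t) //=.
rewrite [X in _ = _ + X]big1 ?addr0 => [|p npt].
  rewrite mulmx_sumr; apply: eq_bigr => q _; rewrite -scalemxAr.
  have [le_tq|lt_qt] := leqP t q; first by rewrite nestV // eqxx.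
  by rewrite triL // !scale0r.
rewrite mulmx_sumr big1 // => q _; rewrite -scalemxAr.
have [le_pq|lt_qp] := leqP p q; last by rewrite triL // scale0r.
by rewrite nestV // eq_sym (negPf npt) scaler0.
Qed.

(** The operators of [Phis j] times [T j] form a family [C *m V]. Its triangular version
    [L *m V = kmul V S] defines the same map, so [Ad (T j)] after [Phis j] is [Ad S] after [Phi],
    and [T j *m invmx S] is the unitary. *)
Lemma nested_cstar_extreme (R : realType) (n m k : nat) (n_gt0 : (0 < n)%N)
    (m_gt0 : (0 < m)%N) (Phi : {linear 'M[R]_n -> 'M[R]_m})
    (V : 'M[R]_(k, n * m)) :
  ucp Phi -> Phi =1 kraus V -> nested V -> cstar_extreme Phi.
Proof.
move=> PhiU PhiV nestV; split=> // r T Phis PhisU uT _ PhiE j.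
have /fin_all_exists[kk KK] i :
    exists k (K : 'M[R]_(k, n * m)), Phis i =1 kraus K.
  have [/(cp_kraus n_gt0 m_gt0)[k' [K [_ defK]]] _] := PhisU i.
  by exists k', K.
have {KK} /fin_all_exists[K KE] := KK.
have gramK : \sum_i (kmul (K i) (T i))^T *m kmul (K i) (T i) = V^T *m V.
  apply/esym/kraus_sum_gram => a; rewrite -PhiV PhiE; apply: eq_bigr => i _.
  by rewrite kraus_kmul KE.
have /submxP[C defC] := sum_gram_submx gramK j.
have [L triL LC] := qr C.
have [S LV] := nested_mul_triangular nestV triL.
have AdS a : Ad (T j) (Phis j a) = Ad S (Phi a).
  rewrite KE -kraus_kmul defC PhiV -kraus_kmul -LV.
  apply: (kraus_gram _ _).2; rewrite !trmx_mul -!mulmxA (mulmxA C^T) -LC.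
  by rewrite !mulmxA.
have TS : S^T *m S = (T j)^T *m T j.
  have := AdS 1%:M; case: (PhisU j) PhiU => [_ ->] [_ ->].
  by rewrite /Ad !mulmx1.
have uS := unitmx_gram TS (uT j).
exists (T j *m invmx S); split=> [|a].
  have UU : (T j *m invmx S)^T *m (T j *m invmx S) = 1%:M.
    rewrite trmx_mul mulmxA -(mulmxA _ (T j)^T) -TS mulmxA -trmx_mul mulmxV //.
    by rewrite trmx1 mul1mx mulmxV.
  by split=> //; apply: mulmx1C.
by rewrite AdM AdS -AdM mulmxV // Ad1.
Qed.

(** * Kraus families of nested compressions *)

Lemma kraus1 (R : realType) (n m : nat) (W : 'M[R]_(n, m)) :
  kraus (mxvec W) =1 Ad W.
Proof.
move=> a; rewrite /kraus big_ord1; congr (Ad _ _).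
by rewrite /kop -[row _ _]/(row _ _) row_id mxvecK.
Qed.

Lemma Ad_eq_scale (R : realType) (n d : nat) (W W' : 'M[R]_(n, d)) :
  Ad W =1 Ad W' -> exists c, W = c *: W'.
Proof.
move=> WW; have /gram_submx/sub_rVP[c defW] : (mxvec W)^T *m mxvec W =
    (mxvec W')^T *m mxvec W'.
  by apply/kraus_gram => a; rewrite !kraus1 WW.
by exists c; apply: (can_inj mxvecK); rewrite linearZ.
Qed.

Lemma Ad_ucp (R : realType) (n d : nat) (W : 'M[R]_(n, d)) :
  Defs.isometry W -> ucp (Ad W).
Proof.
move=> isoW; split; last by rewrite /= /Ad mulmx1.
have [herK posK] := kraus_cp (mxvec W).
split=> [a|r a T]; first by have := herK a; rewrite /= !kraus1.
have := posK r a T; congr psd.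
by apply: eq_bigr => i _; apply: eq_bigr => j _; rewrite /= kraus1.
Qed.

Lemma nested_compressions_kraus (R : realType) (n m k : nat) (d : 'I_k -> nat)
    (Phis : forall j : 'I_k, {linear 'M[R]_n -> 'M[R]_(d j)})
    (Phi : {linear 'M[R]_n -> 'M[R]_m}) :
    nested_compressions (idfun : {linear 'M[R]_n -> 'M[R]_n}) Phis ->
    unitarily_equiv Phi (direct_sum Phis) ->
  exists V : 'M[R]_(k, n * m), Phi =1 kraus V /\ nested V.
Proof.
move=> [_ _ comp0 compS] [U [[UU UU'] PhiU]].
have /fin_all_exists[W WP] (j : 'I_k) :
    exists W : 'M[R]_(n, d j), Defs.isometry W /\ Phis j =1 Ad W.
  case: j => j; elim: j => [|j IH] ltj.
    by have [W WP] := comp0 (Ordinal ltj) erefl; exists W.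
  have [W [isoW PhiW]] := IH (ltnW ltj).
  have [C [isoC PhiC]] := compS (Ordinal (ltnW ltj)) (Ordinal ltj) erefl.
  exists (W *m C); split=> [|a].
    by rewrite /Defs.isometry trmx_mul mulmxA -(mulmxA _ W^T) isoW mulmx1.
  by rewrite PhiC PhiW AdM.
have WW (i j : 'I_k) : (i <= j)%N -> W i *m (W i)^T *m W j = W j.
  case: j => j; elim: j => [|j IH] ltj leij.
    rewrite leqn0 in leij; have <- : i = Ordinal ltj by apply/val_inj/eqP.
    by have [isoW _] := WP i; rewrite -mulmxA isoW mulmx1.
  move: leij; rewrite leq_eqVlt => /predU1P[eij|leij].
    have <- : i = Ordinal ltj by apply: val_inj.
    by have [isoW _] := WP i; rewrite -mulmxA isoW mulmx1.
  pose j' := Ordinal (ltnW ltj).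
  have [C [isoC PhiC]] := compS j' (Ordinal ltj) erefl.
  (* The [W] are chosen separately for each index, so this [W] and [W j' *m C] are only known to
     induce the same map; they differ by a scalar, which keeps the range inside that of [W j']. *)
  have [|c ->] := @Ad_eq_scale R _ _ (W (Ordinal ltj)) (W j' *m C).
    by move=> a; rewrite -(WP _).2 PhiC (WP j').2 AdM.
  by rewrite -scalemxAr mulmxA IH.
pose U_ := submxrow U; have defU : U = \mxrow_j U_ j by rewrite submxrowK.
have UUd i j : i != j -> (U_ i)^T *m U_ j = 0.
  move: UU; rewrite defU tr_mxrow mul_mxcol_mxrow -mxdiagZ /mxdiag.
  move=> /eq_mxblockP UU nij.
  by rewrite UU (negPf nij).
have UU1 i : (U_ i)^T *m U_ i = 1%:M.
  move: UU; rewrite defU tr_mxrow mul_mxcol_mxrow -mxdiagZ /mxdiag.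
  move=> /eq_mxblockP ->.
  by rewrite eqxx conform_mx_id.
(* The blocks [U_ j] are isometries with orthogonal ranges; undoing the conjugation by [U] gives
   these Kraus operators. *)
exists (\matrix_j mxvec (W j *m (U_ j)^T)); split=> [a|t p q le_pq].
  have -> : Phi a = U *m direct_sum Phis a *m U^T.
    by rewrite PhiU /Ad !mulmxA UU' mul1mx -mulmxA UU' mulmx1.
  rewrite /direct_sum [in LHS]defU mul_mxrow_mxdiag tr_mxrow mul_mxrow_mxcol.
  apply: eq_bigr => j _; rewrite kop_mx (WP j).2 /Ad trmx_mul trmxK.
  by rewrite !mulmxA.
rewrite !kop_mx trmx_mul trmxK !mulmxA -(mulmxA (W t)).
have [->|ntp] := eqVneq t p; last first.
  by rewrite UUd // mulmx0 !mul0mx.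
by rewrite UU1 mulmx1 WW.
Qed.

(** The [j]-th space is the range of [kop V j], with orthonormal basis [W j] and projection [P j];
    [(kop V j)^T *m W j] identifies it with the initial space of [kop V j]. *)
Lemma kraus_nested_compressions (R : realType) (n m k : nat)
    (V : 'M[R]_(k, n * m)) (Phi : {linear 'M[R]_n -> 'M[R]_m}) :
    Phi 1%:M = 1%:M -> Phi =1 kraus V -> nested V ->
  exists (d : 'I_k -> nat)
         (Phis : forall j : 'I_k, {linear 'M[R]_n -> 'M[R]_(d j)}),
    nested_compressions (idfun : {linear 'M[R]_n -> 'M[R]_n}) Phis /\
    unitarily_equiv Phi (direct_sum Phis).
Proof.
move=> Phi1 PhiV nestV.
have /fin_all_exists[d] (j : 'I_k) := orthonormal_col_base (kop V j).
move=> /fin_all_exists[W] /all_and2[isoW /fin_all_exists[Y]].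
move=> /all_and2[VY WV]; pose P j := kop V j *m (kop V j)^T.
have VV j : P j *m kop V j = kop V j by rewrite /P -mulmxA nestV // eqxx.
have PW (i j : 'I_k) : (i <= j)%N -> P i *m W j = W j.
  by move=> le_ij; rewrite -VY mulmxA /P -(mulmxA (kop V i)) nestV // eqxx.
have PE j : P j = W j *m (W j)^T.
  (* [W j *m (W j)^T] fixes [P j] and [P j] fixes [W j]; both matrices are symmetric, so they
     agree. *)
  have -> : P j = W j *m (W j)^T *m P j by rewrite /P mulmxA WV.
  rewrite -mulmxA; congr (_ *m _); apply: trmx_inj.
  have symP : (P j)^T = P j by rewrite /P trmx_mul trmxK.
  by rewrite trmx_mul symP trmxK PW.
exists d, (fun j => Ad (W j) : {linear 'M[R]_n -> 'M[R]_(d j)}); split.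
  split=> [|j|j _|i j ij].
  - by split.
  - exact/Ad_ucp/isoW.
  - by exists (W j).
  - exists ((W i)^T *m W j); split=> [|a]; last first.
      by rewrite -AdM mulmxA -PE PW // ij.
    rewrite /Defs.isometry trmx_mul trmxK mulmxA -(mulmxA (W j)^T) -PE.
    by rewrite -mulmxA PW ?ij // isoW.
have Vort i j : i != j -> kop V i *m (kop V j)^T = 0.
  move=> nij; have -> : (kop V j)^T = (kop V j)^T *m P j.
    by rewrite -{1}(VV j) trmx_mul /P trmx_mul trmxK.
  by rewrite /P !mulmxA -(mulmxA (kop V i)) nestV // (negPf nij) mul0mx.
exists (\mxrow_j ((kop V j)^T *m W j)); split; first split.
- rewrite tr_mxrow mul_mxcol_mxrow -mxdiagZ /mxdiag; apply/eq_mxblockP => i j.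
  rewrite trmx_mul trmxK !mulmxA -(mulmxA _ (kop V i)).
  have [eij|nij] := eqVneq i j; last by rewrite Vort // mulmx0 mul0mx.
  by case: j / eij; rewrite conform_mx_id -/(P i) -mulmxA PW // isoW.
(* This product is the sum of the initial projections, that is [Phi 1%:M]. *)
- rewrite tr_mxrow mul_mxrow_mxcol -Phi1 PhiV; apply: eq_bigr => j _.
  rewrite /Ad mulmx1 trmx_mul trmxK !mulmxA -(mulmxA _ (W j)) -PE -mulmxA.
  by rewrite VV.
move=> a; rewrite /Ad tr_mxrow mxcol_mul mul_mxcol_mxrow PhiV.
rewrite /direct_sum /mxdiag; apply/eq_mxblockP => i j.
have E l i' : kop V l *m ((kop V i')^T *m W i') = W i' *+ (l == i').
  have [->|nli] := eqVneq l i'; first by rewrite mulmxA PW.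
  by rewrite mulmxA Vort // mul0mx.
have {}E l : ((kop V i)^T *m W i)^T *m Ad (kop V l) a *m ((kop V j)^T *m W j) =
    (W i *+ (l == i))^T *m a *m (W j *+ (l == j)).
  by rewrite /Ad -!E !trmx_mul !mulmxA.
rewrite /kraus mulmx_sumr mulmx_suml (bigD1 i) //= big1 => [|l nli].
  rewrite E eqxx mulr1n addr0; have [eij|nij] := eqVneq i j.
    by case: j / eij E => _; rewrite mulr1n conform_mx_id.
  by rewrite mulr0n mulmx0.
by rewrite E (negPf nli) mulr0n trmx0 !mul0mx.
Qed.

(** * Algebras of matrices with the factorisation property *)

(* For [x = y] the scalar is [2 / 0 = 0]. *)
Lemma householder (R : realType) (k : nat) (x y : 'rV[R]_k) :
    x *m x^T = 1%:M -> y *m y^T = 1%:M ->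
  let w := y - x in let H := 1%:M - (2 / (w *m w^T) 0 0) *: (w^T *m w) in
  H^T *m H = 1%:M /\ x *m H = y.
Proof.
move=> xx yy w; set s := (w *m w^T) 0 0; set c := 2 / s => H.
have [s0|s_neq0] := eqVneq s 0.
  have w0 : w = 0.
    apply: trmx_inj; rewrite trmx0; apply: gram_eq0; rewrite trmxK.
    by rewrite [LHS]mx11_scalar -/s s0 -scalemx1 scale0r.
  rewrite /H w0 mulmx0 scaler0 subr0 trmx1 !mulmx1; split=> //.
  by apply/eqP; rewrite eq_sym -subr_eq0 -/w w0.
have ww : w *m w^T = s%:M by rewrite [LHS]mx11_scalar.
have symH : H^T = H.
  by rewrite /H linearB linearZ /= trmx1 trmx_mul trmxK.
pose g := x *m y^T.
have yx : y *m x^T = g.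
  rewrite /g -[LHS]trmxK trmx_mul trmxK.
  by rewrite [LHS]mx11_scalar [RHS]mx11_scalar mxE.
have sE : s%:M = 2%:M - g *+ 2 :> 'M_1.
  rewrite -ww /w linearB /= mulmxBl !mulmxBr xx yy yx -/g.
  have -> : 2%:M = 1%:M + 1%:M :> 'M[R]_1 by rewrite -raddfD.
  by rewrite opprB mulr2n opprD addrACA.
have xw : x *m w^T = (- (s / 2))%:M.
  rewrite raddfN /= [s / 2]mulrC scalar_mxM mul_scalar_mx sE.
  rewrite /w linearB /= mulmxBr xx -/g scalerBr -[2%:M]scalemx1 scalerA.
  by rewrite mulVf ?pnatr_eq0 // scale1r -scaler_nat scalerA mulVf ?pnatr_eq0 //
    scale1r opprB.
split.
  have HH (M : 'M_k) : M *m M = s *: M ->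
      (1%:M - c *: M) *m (1%:M - c *: M) = 1%:M.
    move=> MM; rewrite mulmxBl mul1mx mulmxBr mulmx1 -scalemxAl -scalemxAr MM.
    rewrite (scalerA c s) /c divfK // scaler_nat -scalerMnr.
    by rewrite mulr2n opprB addrK subrK.
  by rewrite symH HH // mulmxA -(mulmxA w^T) ww mul_mx_scalar scalemxAl.
have cs : c * - (s / 2) = -1 by rewrite mulrN mulrA divfK // divff ?pnatr_eq0.
rewrite /H mulmxBr mulmx1 -scalemxAr mulmxA xw mul_scalar_mx scalerA cs.
rewrite scaleN1r opprK.
by rewrite /w addrC subrK.
Qed.

Lemma unit_rowP (R : realType) (k : nat) (x : 'rV[R]_k) :
  x != 0 -> exists2 c : R, c != 0 & (c *: x) *m (c *: x)^T = 1%:M.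
Proof.
move=> x_neq0; pose s := (x *m x^T) 0 0.
have s_neq0 : s != 0.
  apply: contraNneq x_neq0 => s0; apply/eqP/trmx_inj; rewrite trmx0.
  apply: gram_eq0; rewrite trmxK [LHS]mx11_scalar -/s s0.
  by rewrite -scalemx1 scale0r.
have s_gt0 : 0 < s by rewrite lt_def s_neq0 row_gram_ge0.
exists (Num.sqrt s)^-1; first by rewrite invr_eq0 sqrtr_eq0 -ltNge.
rewrite linearZ /= -scalemxAl -scalemxAr scalerA -invfM -expr2.
rewrite sqr_sqrtr ?ltW //.
by rewrite [x *m _]mx11_scalar -/s -scalemx1 scalerA mulVf // scale1r.
Qed.

Definition in_unit_interval (R : realType) (k : nat) (b : 'rV[R]_k) : Prop :=
  forall i, 0 < b 0 i <= 1.

(* [ker g] factors every positive definite [D <= 1], written in diagonalised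
   form to spare the spectral theorem. *)
Definition factors (R : realType) (k N : nat) (g : 'M[R]_k -> 'rV[R]_N) :
    Prop :=
  forall (O : 'M[R]_k) (b : 'rV[R]_k), O^T *m O = 1%:M -> in_unit_interval b ->
    exists2 L, g L = 0 & L^T *m L = O^T *m diag_mx b *m O.

(** Suppose [y |-> g (y^T *m x)] is injective and [x] is a unit row. Factor the matrix with
    eigenvalue 1 on [x] and [t ^+ 2] on its complement: [y = x *m L^T] is a unit row, the entries of
    [L - y^T *m x] are at most [t], and [g L = 0] bounds [y] by a multiple of [t]. A small [t] gives
    a contradiction. *)
Lemma factors_rank1 (R : realType) (k N : nat)
    (g : {linear 'M[R]_k -> 'rV[R]_N}) (x : 'rV[R]_k) :
  factors g -> x != 0 -> exists2 y : 'rV[R]_k, y != 0 & g (y^T *m x) = 0.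
Proof.
case: k g x => [|k] g x facg x_neq0.
  by case/eqP: x_neq0; apply/rowP => -[].
wlog xx : x x_neq0 / x *m x^T = 1%:M.
  move=> IH; have [c c_neq0 cc] := unit_rowP x_neq0.
  have [|//|y y_neq0] := IH (c *: x).
    by rewrite scaler_eq0 negb_or c_neq0.
  rewrite -scalemxAr linearZ => /eqP; rewrite scaler_eq0 (negPf c_neq0) /=.
  by move/eqP; exists y.
pose f (y : 'rV[R]_k.+1) := g (y^T *m x).
have f_lin : linear f.
  by move=> c u v; rewrite /f linearP /= mulmxDl -scalemxAl linearP.
pose fL : {linear _ -> _} := HB.pack f (GRing.isLinear.Build _ _ _ _ f f_lin).
pose F := lin1_mx fL.
have FE y : y *m F = g (y^T *m x) by rewrite mul_rV_lin1.
have [freeF|] := boolP (row_free F); last first.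
  rewrite -kermx_eq0 => /rowV0Pn[y /sub_kermxP yF y_neq0].
  by exists y; rewrite // -FE.
have [O [OO rowO]] : exists O : 'M[R]_k.+1, O^T *m O = 1%:M /\ row 0 O = x.
  have ee : delta_mx 0 0 *m (delta_mx 0 0 : 'rV[R]_k.+1)^T = 1%:M.
    rewrite trmx_delta mul_delta_mx.
    by apply/matrixP => i j; rewrite !ord1 !mxE.
  have [] := householder ee xx; set O := 1%:M - _ => OO eO.
  by exists O; rewrite rowE.
(* [G] recovers [y] from [X = L - y^T *m x]: as [g L = 0], [y = - (mxvec X *m G)]. *)
pose G := lin1_mx (g \o vec_mx) *m pinvmx F.
have GE X : mxvec X *m G = g X *m pinvmx F.
  by rewrite mulmxA mul_rV_lin1 /= mxvecK.
pose C := \sum_i \sum_l `|G i l|.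
have C_ge0 : 0 <= C by apply: sumr_ge0 => i _; apply: sumr_ge0.
(* The entries of [y] will be at most [t * C], so its squared norm is at most
   [t ^+ 2 * K <= t * K < 1]. *)
pose K := k.+1%:R * C ^+ 2.
have K_ge0 : 0 <= K by rewrite mulr_ge0 // exprn_ge0.
pose t := (1 + K)^-1.
have t_gt0 : 0 < t by rewrite invr_gt0 ltr_wpDr.
have t_le1 : t <= 1 by rewrite invf_le1 ?lerDl // ltr_wpDr.
pose b : 'rV[R]_k.+1 := \row_i (if i == 0 then 1 else t ^+ 2).
have [|L gL LL] := facg O b OO.
  move=> i; rewrite mxE; case: ifP => _; rewrite ?ltr01 ?lexx //.
  by rewrite exprn_gt0 // exprn_ile1 // ltW.
have {}LL : L^T *m L = (t ^+ 2)%:M + (1 - t ^+ 2) *: (x^T *m x).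
  have -> : x^T *m x = O^T *m delta_mx 0 0 *m O.
    rewrite -rowO rowE trmx_mul trmx_delta -!mulmxA.
    by rewrite (mulmxA (delta_mx _ _)) mul_delta_mx.
  have -> : (t ^+ 2)%:M = O^T *m (t ^+ 2)%:M *m O.
    by rewrite mul_mx_scalar -scalemxAl OO scalemx1.
  rewrite LL scalemxAl scalemxAr -mulmxDl -mulmxDr; congr (_ *m _ *m _).
  apply/matrixP => i j; rewrite !mxE.
  have [<-|nij] := eqVneq i j; last first.
    rewrite !mulr0n add0r.
    case: (eqVneq i 0) nij => [->|]; last by rewrite mulr0.
    by rewrite eq_sym => /negPf->; rewrite mulr0.
  rewrite !mulr1n; case: eqP => _; first by rewrite mulr1 addrC subrK.
  by rewrite mulr0 addr0.
pose y := x *m L^T; pose X := L - y^T *m x.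
have yy : y *m y^T = 1%:M.
  rewrite /y trmx_mul trmxK mulmxA -(mulmxA x) LL mulmxDr mulmxDl.
  rewrite mul_mx_scalar -scalemxAl xx -scalemxAr -scalemxAl mulmxA xx mul1mx xx.
  by rewrite -scalerDl addrC subrK scale1r.
have [P [PE symP Px]] : exists P : 'M[R]_k.+1,
    [/\ P = 1%:M - x^T *m x, P^T = P & x *m P = 0].
  exists (1%:M - x^T *m x); split=> //.
    by rewrite [LHS]linearB /= trmx1 trmx_mul trmxK.
  by rewrite mulmxBr mulmx1 mulmxA xx mul1mx subrr.
have PP : P *m P = P by rewrite {1}PE mulmxBl mul1mx -mulmxA Px mulmx0 subr0.
have XX : X^T *m X = (t ^+ 2) *: P.
  (* Multiplying by the projection [P] on both sides of [L^T *m L] leaves only the eigenvalue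
     [t ^+ 2]. *)
  have -> : X = L *m P by rewrite PE mulmxBr mulmx1 mulmxA /X /y trmx_mul trmxK.
  rewrite trmx_mul symP mulmxA -(mulmxA _ L^T) LL -mulmxA mulmxDl -scalemxAl.
  rewrite -(mulmxA x^T) Px mulmx0 scaler0 addr0 mul_scalar_mx -scalemxAr.
  by rewrite PP.
have X_le i j : `|X i j| <= t.
  rewrite -(@ler_pXn2r _ 2) ?nnegrE ?(ltW t_gt0) // real_normK ?num_real //.
  apply: (@le_trans _ _ ((X^T *m X) j j)).
    rewrite [leRHS]mxE (bigD1 i) //= [X^T _ _]mxE -expr2 lerDl.
    by rewrite sumr_ge0 // => l _; rewrite [X^T _ _]mxE -expr2 sqr_ge0.
  rewrite XX PE mxE [X in _ * X]mxE [1%:M _ _]mxE eqxx [(- _ : 'M__) _ _]mxE.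
  by rewrite ler_piMr ?sqr_ge0 // gerBl gram_diag_ge0.
have yE : y = - (mxvec X *m G).
  rewrite GE /X linearB /= gL sub0r mulNmx opprK -FE -mulmxA mulmxVp //.
  by rewrite mulmx1.
have y_le l : `|y 0 l| <= t * C.
  rewrite yE mxE normrN mxE; apply: le_trans (ler_norm_sum _ _ _) _.
  rewrite /C mulr_sumr; apply: ler_sum => ij _; rewrite normrM.
  apply: ler_pM => //; last first.
    by rewrite (bigD1 l) //= lerDl sumr_ge0.
  by case/mxvec_indexP: ij => i j; rewrite mxvecE.
have /matrixP/(_ 0 0) := yy; rewrite mxE [RHS]mxE mulr1n.
have : \sum_l y 0 l * y^T l 0 <= \sum_(l < k.+1) (t * C) ^+ 2.
  apply: ler_sum => l _; rewrite [y^T _ _]mxE -expr2 -real_normK ?num_real //.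
  by rewrite ler_pXn2r ?nnegrE ?mulr_ge0 // ltW.
rewrite sumr_const card_ord => le1 yy1; exfalso.
move: le1; rewrite yy1 exprMn -mulr_natl mulrCA -/K; apply/negP; rewrite -ltNge.
apply: le_lt_trans (_ : t * K < 1).
  by rewrite ler_wpM2r // expr2 ger_pMr.
by rewrite mulrC ltr_pdivrMr ?mul1r ?ltrDr // ltr_wpDr.
Qed.

(* For [x] minimising the rank of [{y | y^T *m x \in ker g}], any nonzero [y] of
   that space works: if [z *m y^T != 0] then multiplication by [y^T *m x] shows
   that the space of [z] is contained in, hence equal to, the one of [x], and
   every [z] is the difference of two such rows. *)
Lemma factors_common_col (R : realType) (k N : nat)
    (g : {linear 'M[R]_k.+1 -> 'rV[R]_N}) :
  factors g ->
  (forall X Y, g X = 0 -> g Y = 0 -> g (X *m Y) = 0) ->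
  exists2 y : 'rV[R]_k.+1, y != 0 & forall z : 'rV[R]_k.+1, g (y^T *m z) = 0.
Proof.
move=> facg mulg.
have Flin x : linear (fun y : 'rV[R]_k.+1 => g (y^T *m x)).
  by move=> c u v; rewrite linearP /= mulmxDl -scalemxAl linearP.
pose fL x : {linear _ -> _} :=
  HB.pack (fun y : 'rV[R]_k.+1 => g (y^T *m x))
    (GRing.isLinear.Build _ _ _ _ _ (Flin x)).
pose H x := kermx (lin1_mx (fL x)).
have HE x y : (y <= H x)%MS <-> g (y^T *m x) = 0.
  by split=> [/sub_kermxP|gyx]; [|apply/sub_kermxP]; rewrite mul_rV_lin1.
have exr : exists r, `[< exists2 x, x != 0 & \rank (H x) = r >].
  exists (\rank (H (const_mx 1))); apply/asboolP; exists (const_mx 1) => //.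
  apply/eqP => /rowP/(_ 0)/eqP; rewrite !mxE; exact/negP/oner_neq0.
case: (ex_minnP exr) => _ /asboolP[x x_neq0 <-] minx.
have [y y_neq0 gyx] := factors_rank1 facg x_neq0; exists y => //.
have key z : z *m y^T != 0 -> g (y^T *m z) = 0.
  move=> zy; have z_neq0 : z != 0 by apply: contraNneq zy => ->; rewrite mul0mx.
  have sub : (H z <= H x)%MS.
    apply/rV_subP => u /HE guz; apply/HE.
    have := mulg _ _ guz gyx; rewrite mulmxA -(mulmxA u^T) [z *m _]mx11_scalar.
    rewrite mul_mx_scalar -scalemxAl linearZ => /eqP; rewrite scaler_eq0.
    case/orP=> [/eqP zy0|/eqP //].
    by rewrite [z *m _]mx11_scalar zy0 -scalemx1 scale0r eqxx in zy.
  have rk : \rank (H x) = \rank (H z).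
    apply/eqP; rewrite eqn_leq [X in _ && X]mxrankS // andbT.
    by apply: minx; apply/asboolP; exists z.
  have /eqmxP eqH : (H z == H x)%MS by rewrite -(mxrank_leqif_eq sub) rk.
  by apply/HE; rewrite eqH; apply/HE.
move=> z; have [/eqP zy0|] := boolP (z *m y^T == 0); last exact: key.
have yy_neq0 : y *m y^T != 0.
  apply: contraNneq y_neq0 => yy0; apply/eqP/trmx_inj; rewrite trmx0.
  by apply: gram_eq0; rewrite trmxK.
rewrite -[z](addrK y) mulmxBr linearB /= !key ?subrr //.
by rewrite mulmxDl zy0 add0r.
Qed.

(** The common row [f], normalised, is the first row of [Q]. The induction runs on the complement of
    [f]: [U] rotates [e] to [f], and [g'] tests matrices supported there. To factor a matrix there,
    factor its direct sum with 1 and correct the factor so that it fixes [f]. *)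
Lemma factors_triangular (R : realType) (k N : nat)
    (g : {linear 'M[R]_k -> 'rV[R]_N}) :
  factors g -> g 1%:M = 0 ->
  (forall X Y, g X = 0 -> g Y = 0 -> g (X *m Y) = 0) ->
  exists Q : 'M[R]_k, Q^T *m Q = 1%:M /\
    forall p q : 'I_k, (p <= q)%N -> g ((row p Q)^T *m row q Q) = 0.
Proof.
elim: k g => [|k IH] g facg g1 mulg.
  by exists 1%:M; split=> [|[]//]; rewrite trmx1 mulmx1.
have [f0 f0_neq0 gf0] := factors_common_col facg mulg.
have [c c_neq0 ff] := unit_rowP f0_neq0; set f := c *: f0 in ff.
have gf z : g (f^T *m z) = 0.
  by rewrite /f [_^T]linearZ /= -scalemxAl linearZ /= gf0 scaler0.
clearbody f; clear c c_neq0 f0 f0_neq0 gf0.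
rewrite -[k.+1]/(1 + k)%N in g facg g1 mulg f ff gf *.
pose e : 'rV[R]_(1 + k) := row_mx 1%:M 0.
have ee : e *m e^T = 1%:M.
  by rewrite tr_row_mx mul_row_col trmx1 mulmx1 mul0mx addr0.
have [U UU eU] : exists2 U : 'M_(1 + k), U^T *m U = 1%:M & e *m U = f.
  by have [] := householder ee ff; set U := 1%:M - _; exists U.
have UU' : U *m U^T = 1%:M by apply: mulmx1C.
pose dblk (C : 'M[R]_k) : 'M[R]_(1 + k) := block_mx 0 0 0 C.
have dblkM C D : dblk (C *m D) = dblk C *m dblk D.
  by rewrite /dblk mulmx_block !mul0mx !mulmx0 !addr0 add0r.
have ete : e^T *m e = block_mx 1%:M 0 0 0.
  by rewrite tr_row_mx mul_col_row trmx1 trmx0 !mul0mx !mulmx0 mulmx1.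
have g'_lin : linear (fun C => g (Ad U (dblk C))).
  move=> c C D; rewrite -!linearP /dblk; congr (g (Ad U _)).
  by rewrite scale_block_mx add_block_mx !scaler0 !addr0.
pose g' : {linear _ -> _} := HB.pack (fun C => g (Ad U (dblk C)))
  (GRing.isLinear.Build _ _ _ _ _ g'_lin).
have AdUM X Y : Ad U (X *m Y) = Ad U X *m Ad U Y.
  by rewrite /Ad !mulmxA -(mulmxA _ U) UU' mulmx1.
have Ade : Ad U (e^T *m e) = f^T *m f.
  by rewrite /Ad -eU trmx_mul !mulmxA.
have [|||Q' [QQ triQ]] := IH g'.
- move=> O b OO b01; rewrite /=.
  pose O' := block_mx 1%:M 0 0 O *m U; pose b' : 'rV_(1 + k) := row_mx 1%:M b.
  have [||L gL LL] := facg O' b'.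
  + rewrite trmx_mul mulmxA -(mulmxA U^T) tr_block_mx mulmx_block OO !trmx0.
    rewrite !mul0mx !mulmx0 !addr0 add0r trmx1 mulmx1 -scalar_mx_block.
    by rewrite mulmx1.
  + move=> i; rewrite -[i](@splitK 1 k); case: split => i' /=.
      by rewrite row_mxEl !ord1 mxE ltr01 lexx.
    by rewrite row_mxEr.
  have {}LL : L^T *m L = Ad U (block_mx 1%:M 0 0 (O^T *m diag_mx b *m O)).
    rewrite LL -[LHS]/(Ad O' (diag_mx b')) AdM; congr (Ad U _).
    have -> : diag_mx b' = block_mx 1%:M 0 0 (diag_mx b).
      rewrite /b' diag_mx_row; congr block_mx.
      by apply/matrixP => i j; rewrite !ord1 !mxE.
    rewrite /Ad tr_block_mx !mulmx_block !trmx0.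
    by rewrite !(mulmx0, mul0mx) !(addr0, add0r) trmx1 !mulmx1 mul0mx.
  pose y := f *m L^T.
  have fU : f *m U^T = e by rewrite -eU -mulmxA UU' mulmx1.
  have Uf : U *m f^T = e^T by rewrite -fU trmx_mul trmxK.
  have eblk D : e *m block_mx 1%:M 0 0 D = e :> 'rV[R]_(1 + k).
    by rewrite mul_row_block !mul0mx !mulmx0 mulmx1 !addr0.
  have yy : y *m y^T = 1%:M.
    rewrite /y trmx_mul trmxK mulmxA -(mulmxA f) LL /Ad !mulmxA fU.
    by rewrite -(mulmxA _ U) Uf eblk ee.
  (* The reflection takes [y] to [f], so [L'] fixes [f^T]. It stays in the kernel of [g] because
     [w^T = f^T - L *m f^T] and the kernel contains every [f^T *m z] and is closed under
     products. *)
  have [] := householder yy ff; set w := f - y; set c := 2 / _.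
  set H := 1%:M - _ => HH yH; pose L' := H^T *m L.
  have gw z : g (w^T *m z) = 0.
    rewrite /w [_^T]linearB /= mulmxBl linearB /= gf sub0r /y trmx_mul trmxK.
    by rewrite -mulmxA mulg ?oppr0.
  have gL' : g L' = 0.
    have -> : L' = L - c *: (w^T *m (w *m L)).
      rewrite /L' /H [_^T]linearB /= mulmxBl trmx1 mul1mx [_^T]linearZ /=.
      by rewrite trmx_mul trmxK -scalemxAl mulmxA.
    by rewrite linearB linearZ /= gL gw scaler0 subr0.
  have LL' : L'^T *m L' = Ad U (block_mx 1%:M 0 0 (O^T *m diag_mx b *m O)).
    by rewrite trmx_mul trmxK mulmxA -(mulmxA L^T) (mulmx1C HH) mulmx1.
  have Lf : L' *m f^T = f^T.
    by rewrite -[in RHS]yH /y !trmx_mul trmxK !mulmxA.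
  clearbody L'; pose M := U *m L' *m U^T.
  have AdM' : Ad U M = L' by rewrite /Ad /M !mulmxA UU mul1mx -mulmxA UU mulmx1.
  have Me : M *m e^T = e^T.
    by rewrite /M -Uf !mulmxA -(mulmxA _ U^T) UU mulmx1 -mulmxA Lf. 
  have MM : M^T *m M = block_mx 1%:M 0 0 (O^T *m diag_mx b *m O).
    rewrite /M !trmx_mul trmxK !mulmxA -(mulmxA _ U^T) UU mulmx1.
    rewrite -(mulmxA _ L'^T) LL' /Ad !mulmxA UU' mul1mx.
    by rewrite -(mulmxA _ U) UU' mulmx1.
  have [B [C ME]] : exists B C, M = block_mx 1%:M B 0 C.
    exists (ursubmx M), (drsubmx M); rewrite -[LHS]submxK.
    move: Me; rewrite -[M in LHS]submxK tr_row_mx mul_block_col trmx1 trmx0.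
    by rewrite !mulmx0 !mulmx1 !addr0 => /eq_col_mx[-> ->].
  (* The upper right block of [M^T *m M] is [B], so [B = 0] and [C] is the factor sought. *)
  move: MM; rewrite ME tr_block_mx mulmx_block trmx1 !trmx0 !mul1mx !mul0mx.
  rewrite !addr0 !mulmx1 !mulmx0 addr0 => /eq_block_mx[_ B0 _].
  rewrite B0 mulmx0 add0r => CC; exists C => //.
  have -> : dblk C = M - e^T *m e.
    by rewrite ME B0 ete opp_block_mx add_block_mx !oppr0 !addr0 subrr.
  by rewrite linearB linearB /= AdM' Ade gL' gf subr0.
- have -> : g' 1%:M = g (Ad U (1%:M - e^T *m e)).
    congr (g (Ad U _)); rewrite ete scalar_mx_block opp_block_mx add_block_mx.
    by rewrite !oppr0 !addr0 subrr.
  by rewrite linearB linearB /= Ade gf subr0 /Ad mulmx1 UU.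
- by move=> X Y /= gX gY; rewrite dblkM AdUM mulg.
exists (block_mx 1%:M 0 0 Q' *m U); split.
  rewrite trmx_mul mulmxA -(mulmxA U^T) tr_block_mx mulmx_block QQ !trmx0.
  rewrite !mul0mx !mulmx0 !addr0 add0r trmx1 mulmx1 -scalar_mx_block.
  by rewrite mulmx1.
move=> p q; rewrite -[p](@splitK 1 k) -[q](@splitK 1 k) !row_mul.
have rowl (i : 'I_1) : row (lshift k i) (block_mx 1%:M 0 0 Q') = e.
  by rewrite rowKu row_row_mx !row0; congr row_mx; rewrite ord1 row_id.
have rowr i :
    row (rshift 1 i) (block_mx (1%:M : 'M_1) 0 0 Q') = row_mx 0 (row i Q').
  by rewrite rowKd row_row_mx row0.
case: (split p) => [p'|p'] /=; first by rewrite rowl eU gf.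
case: (split q) => [q'|q'] /=; first by rewrite !ord1.
rewrite !rowr leq_add2l => /triQ gpq; rewrite -[RHS]gpq /=; congr (g _).
rewrite trmx_mul mulmxA /Ad /dblk -(mulmxA U^T) tr_row_mx mul_col_row.
by rewrite !trmx0 !mul0mx mulmx0.
Qed.

(** * C*-extreme maps *)

Definition kgram (R : realType) (n m k : nat) (V W : 'M[R]_(k, n * m)) :
    'M[R]_m :=
  \sum_l (kop V l)^T *m kop W l.

(* The only [S] that can satisfy [L *m V = kmul V S] is [kgram V (L *m V)]. *)
Definition defect (R : realType) (n m k : nat) (V : 'M[R]_(k, n * m))
  (L : 'M[R]_k) : 'rV[R]_(k * (n * m)) :=
  mxvec (L *m V - kmul V (kgram V (L *m V))).

Lemma defect_linear (R : realType) (n m k : nat) (V : 'M[R]_(k, n * m)) :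
  linear (defect V).
Proof.
move=> c L M; rewrite /defect -linearP; congr mxvec.
have kopD (X Y : 'M[R]_(k, n * m)) l :
    kop (c *: X + Y) l = c *: kop X l + kop Y l.
  by rewrite /kop !linearP.
have -> : kgram V ((c *: L + M) *m V) =
    c *: kgram V (L *m V) + kgram V (M *m V).
  rewrite /kgram scaler_sumr -big_split; apply: eq_bigr => l _ /=.
  by rewrite mulmxDl -scalemxAl kopD mulmxDr -scalemxAr.
have -> (X Y : 'M[R]_m) : kmul V (c *: X + Y) = c *: kmul V X + kmul V Y.
  by apply: kop_inj => l; rewrite kopD !kop_kmul mulmxDr -scalemxAr.
by rewrite mulmxDl -scalemxAl scalerBr opprD addrACA.
Qed.

HB.instance Definition _ (R : realType) (n m k : nat) (V : 'M[R]_(k, n * m)) :=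
  GRing.isLinear.Build R 'M[R]_k 'rV[R]_(k * (n * m)) _ (defect V)
    (defect_linear V).

Section Extreme.
Variables (R : realType) (n m k : nat).
Implicit Types V W : 'M[R]_(k, n * m).

Lemma kraus_kgram V : kraus V 1%:M = kgram V V.
Proof. by apply: eq_bigr => l _; rewrite /Ad mulmx1. Qed.

Lemma kgram_kmul V W (S : 'M[R]_m) : kgram V (kmul W S) = kgram V W *m S.
Proof.
by rewrite /kgram mulmx_suml; apply: eq_bigr => l _; rewrite kop_kmul mulmxA.
Qed.

Lemma kmul1 V : kmul V 1%:M = V.
Proof. by apply: kop_inj => l; rewrite kop_kmul mulmx1. Qed.

Lemma defectP V (L : 'M[R]_k) : kraus V 1%:M = 1%:M ->
  defect V L = 0 <-> exists S : 'M[R]_m, L *m V = kmul V S.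
Proof.
move=> V1; split=> [|[S LV]].
  move=> /(congr1 vec_mx); rewrite mxvecK linear0 => /eqP.
  by rewrite subr_eq0 => /eqP LV; exists (kgram V (L *m V)).
by rewrite /defect LV kgram_kmul -kraus_kgram V1 mul1mx subrr linear0.
Qed.

(** The row space of [T] contains those of all [kop W l]; as [B] is invertible, it contains those of
    all [kop V l], hence that of [1 = \sum_l (kop V l)^T *m kop V l]. *)
Lemma kraus1_gram V (B : 'M[R]_k) : kraus V 1%:M = 1%:M -> B \in unitmx ->
  exists2 T : 'M[R]_m, T \in unitmx & T^T *m T = kraus (B *m V) 1%:M.
Proof.
move=> V1 uB; set W := B *m V.
have [|T _ WT] := @cholesky R m (kgram W W).
  by apply: form_ge0_sum => l; apply: form_ge0_gram.
have WsubT := @sum_gram_submx R 'I_k (fun=> n) m m (kop W) T WT.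
exists T; last by rewrite kraus_kgram.
rewrite -row_full_unit -sub1mx -V1 kraus_kgram summx_sub // => l _.
apply: mulmx_sub; have -> : V = invmx B *m W by rewrite mulKmx.
by rewrite kop_mul summx_sub // => q _; rewrite scalemx_sub.
Qed.

(** Split [V] by coefficients with Gram matrices [D / 2] and [1 - D / 2], and normalise both parts
    to unital maps. Extremality makes the first equivalent to [Phi], so [B ord0 *m W] and [V] differ
    by an orthogonal [Q], and [Q^T *m B ord0] factors [D / 2]. *)
Lemma cstar_extreme_factors (Phi : {linear 'M[R]_n -> 'M[R]_m}) V :
  cstar_extreme Phi -> Phi =1 kraus V -> row_free V -> factors (defect V).
Proof.
move=> [[_ Phi1] extPhi] PhiV freeV O b OO b01.
have V1 : kraus V 1%:M = 1%:M by rewrite -PhiV.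
(* Halving keeps the second weight positive when [b 0 j = 1]; the final factor [Num.sqrt 2] undoes
   it. *)
pose s (i : 'I_2) : 'rV[R]_k :=
  \row_j if i == 0 then b 0 j / 2 else 1 - b 0 j / 2.
pose B i : 'M[R]_k := diag_mx (map_mx Num.sqrt (s i)) *m O.
have s_gt0 i j : 0 < s i 0 j.
  have /andP[b_gt0 b_le1] := b01 j.
  rewrite mxE; case: ifP => _; first by rewrite divr_gt0.
  by rewrite subr_gt0 ltr_pdivrMr // mul1r (le_lt_trans b_le1) // ltr1n.
have BB i : (B i)^T *m B i = Ad O (diag_mx (s i)).
  rewrite trmx_mul tr_diag_mx !mulmxA -(mulmxA O^T) mulmx_diag.
  congr (_ *m diag_mx _ *m _).
  by apply/rowP => j; rewrite mxE ![map_mx _ _ _ _]mxE -expr2 sqr_sqrtr // ltW.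
have uB i : B i \in unitmx.
  rewrite unitmx_mul; apply/andP; split; last by have [] := mulmx1_unit OO.
  rewrite unitmxE det_diag unitfE; apply/prodf_neq0 => j _.
  by rewrite mxE sqrtr_eq0 -ltNge.
have sumB : \sum_i (B i *m V)^T *m (B i *m V) = V^T *m V.
  under eq_bigr => i _ do rewrite trmx_mul mulmxA -(mulmxA V^T) BB.
  rewrite -mulmx_suml -mulmx_sumr -linear_sum -linear_sum big_ord_recl big_ord1.
  have -> : s ord0 + s (lift ord0 ord0) = const_mx 1.
    by apply/rowP => j; rewrite !mxE /= addrC subrK.
  by rewrite /= diag_const_mx /Ad mulmx1 OO mulmx1.
have sumBV a : kraus V a = \sum_i kraus (B i *m V) a.
  by apply/kraus_sum_gram: a.
have /fin_all_exists2[T uT TT] i := kraus1_gram V1 (uB i).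
pose Psi i : {linear 'M[R]_n -> 'M[R]_m} :=
  kraus (kmul (B i *m V) (invmx (T i))).
have [||||U [[UU UU'] PhiU]] := extPhi 2 T Psi _ _ _ _ ord0.
- move=> i; split; first exact: kraus_cp.
  rewrite /= kraus_kmul -TT /Ad mulmxA -(mulmxA _ (T i)) mulmxV // mulmx1.
  by rewrite -trmx_mul mulmxV // trmx1.
- exact: uT.
- by under eq_bigr => i _ do rewrite TT; rewrite -sumBV.
- move=> a; rewrite PhiV sumBV; apply: eq_bigr => i _.
  by rewrite /= kraus_kmul -AdM mulVmx // Ad1.
pose S := invmx (T ord0) *m U.
have uS : S \in unitmx.
  by rewrite unitmx_mul unitmx_inv uT; have [] := mulmx1_unit UU.
pose W := kmul V S.
have BW : (B ord0 *m W)^T *m (B ord0 *m W) = V^T *m V.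
  apply/kraus_gram => a; rewrite -PhiV PhiU /= -kraus_kmul -kmulA.
  by rewrite kmul_mul.
have /submxP[Q defQ] := gram_submx BW.
have QQ : Q^T *m Q = 1%:M.
  apply: (row_free_inj freeV); rewrite mul1mx; apply: trmx_inj.
  apply: (row_free_inj freeV); rewrite /= -BW defQ.
  by rewrite !trmx_mul trmxK !mulmxA.
pose L := Q^T *m B ord0.
exists (Num.sqrt 2 *: L).
  rewrite linearZ /=; have -> : defect V L = 0; last by rewrite scaler0.
  apply/(defectP _ V1); exists (invmx S).
  have LW : L *m W = V by rewrite /L -mulmxA defQ mulmxA QQ mul1mx.
  by rewrite -[in RHS]LW kmul_mul -kmulA mulmxV // kmul1.
rewrite [(_ *: L)^T]linearZ /= -scalemxAl -scalemxAr scalerA.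
rewrite -expr2 sqr_sqrtr //.
rewrite trmx_mul trmxK mulmxA -(mulmxA _ Q) (mulmx1C QQ) mulmx1 BB -linearZ.
congr (Ad O _); rewrite -linearZ; congr diag_mx; apply/rowP => j.
by rewrite !mxE mulrC divfK ?pnatr_eq0.
Qed.

(** In the basis of the rows of [Q] these products are matrix units, so [S] sends the [p]-th
    operator of [Q *m V] to the [q]-th and the others to 0; unitality then determines [S]. *)
Lemma triangular_nested V (Q : 'M[R]_k) :
    kraus V 1%:M = 1%:M -> Q^T *m Q = 1%:M ->
    (forall p q : 'I_k, (p <= q)%N -> defect V ((row p Q)^T *m row q Q) = 0) ->
  nested (Q *m V).
Proof.
move=> V1 QQ triQ t p q /triQ/(defectP _ V1)[S VS].
have QV1 : kraus (Q *m V) 1%:M = 1%:M.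
  rewrite -V1; apply: (kraus_gram _ _).2.
  by rewrite trmx_mul mulmxA -(mulmxA V^T) QQ mulmx1.
have QVS l : kop (Q *m V) l *m S = kop (Q *m V) q *+ (l == p).
  rewrite -kop_kmul kmul_mul -VS !mulmxA.
  have -> : Q *m (row p Q)^T = delta_mx p 0.
    by rewrite rowE trmx_mul mulmxA (mulmx1C QQ) mul1mx trmx_delta.
  rewrite /kop -mulmxA (row_mul l) -(row_mul q).
  have -> : row l (delta_mx p 0) = ((l == p)%:R)%:M :> 'M[R]_1.
    by apply/matrixP => i j; rewrite !ord1 !mxE andbT mulr1n.
  by rewrite mul_scalar_mx scaler_nat raddfMn.
have SE : S = (kop (Q *m V) p)^T *m kop (Q *m V) q.
  rewrite -[LHS]mul1mx -QV1 kraus_kgram /kgram mulmx_suml (bigD1 p) //=.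
  rewrite -mulmxA QVS eqxx big1 ?addr0 // => l nlp.
  by rewrite -mulmxA QVS (negPf nlp) mulr0n mulmx0.
by rewrite -SE QVS.
Qed.
End Extreme.

Theorem corollary3p28 (R : realType) (n m : nat) (n_gt0 : (0 < n)%N)
    (m_gt0 : (0 < m)%N) (Phi : {linear 'M[R]_n -> 'M[R]_m}) (PhiU : ucp Phi) :
  cstar_extreme Phi <->
  exists (k : nat) (d : 'I_k -> nat)
         (Phis : forall j : 'I_k, {linear 'M[R]_n -> 'M[R]_(d j)}),
    nested_compressions (idfun : {linear 'M[R]_n -> 'M[R]_n}) Phis /\
    unitarily_equiv Phi (direct_sum Phis).
Proof.
split=> [extPhi|[k [d [Phis [nestPhis PhisU]]]]]; last first.
  have [V [PhiV nestV]] := nested_compressions_kraus nestPhis PhisU.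
  exact: nested_cstar_extreme PhiU PhiV nestV.
have [PhiCP Phi1] := PhiU.
have [k [V [freeV PhiV]]] := cp_kraus n_gt0 m_gt0 PhiCP.
have V1 : kraus V 1%:M = 1%:M by rewrite -PhiV.
have facV := cstar_extreme_factors extPhi PhiV freeV.
have [||Q [QQ triQ]] := factors_triangular facV.
- by apply/(defectP _ V1); exists 1%:M; rewrite kmul1 mul1mx.
(* The right factors multiply: [X *m Y *m V = X *m kmul V T = kmul V (S *m T)]. *)
- move=> X Y /(defectP _ V1)[S XV] /(defectP _ V1)[T YV].
  apply/(defectP _ V1); exists (S *m T).
  by rewrite -mulmxA YV -kmul_mul XV kmulA.
exists k; apply: (@kraus_nested_compressions _ _ _ _ (Q *m V)) => // [a|].
  rewrite PhiV; apply: (kraus_gram _ _).2.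
  by rewrite trmx_mul mulmxA -(mulmxA V^T) QQ mulmx1.
exact: triangular_nested V1 QQ triQ.
Qed.
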